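(* There exist no semi-equivelar maps of types $(3^4,8)$, $(3^2,4,3,6)$, $(3,6,4,6)$, $(4^3,6)$ or $(4,8,12)$ on the closed surface of Euler characteristic $-1$. *)

(* Defs.v *)
From HB Require Import structures.
From mathcomp Require Import all_boot all_order all_algebra.
Set Implicit Arguments. Unset Strict Implicit. Unset Printing Implicit Defensive.

Section Maps.
Variables (V Fc : finType) (face : Fc -> seq V).
(* A map is given by a finite vertex type [V], a finite type of face labels
   [Fc], and for each face label the boundary cycle of the face, listed as a
   cyclic sequence of vertices (consecutive entries, cyclically, are joined by
   an edge of the face). *)

Definition face_edges (f : seq V) : {set {set V}} :=
  [set [set x; next f x] | x in f].

Definition map_edges : {set {set V}} :=
  \bigcup_(i : Fc) face_edges (face i).

Definition link_rel (v : V) : rel Fc := fun i j =>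
  [&& v \in face i, v \in face j, i != j &
      [exists e in face_edges (face i) :&: face_edges (face j), v \in e]].

Definition face_adj : rel Fc := fun i j =>
  (i != j) && [exists e, (e \in face_edges (face i)) && (e \in face_edges (face j))].

(* [face] describes a polyhedral map on a connected closed surface:
   - every face is a p-gon (p >= 3) with distinct vertices,
   - every vertex lies on some face,
   - two distinct faces meet in the empty set, a vertex, or a common edge,
   - every edge lies in exactly two faces,
   - the faces around each vertex form a single cycle (the link of each
     vertex is connected), so the complex is a closed surface,
   - the surface is connected. *)
Definition polyhedral_surface_map : Prop :=
  (forall i, uniq (face i) && (3 <= size (face i))) /\
  [/\ (forall v : V, exists i, v \in face i),
      (forall i j, i != j ->
        let S := [set x in face i] :&: [set x in face j] in
        (#|S| <= 1) || ((S \in face_edges (face i)) && (S \in face_edges (face j)))),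
      (forall e, e \in map_edges -> #|[set i | e \in face_edges (face i)]| = 2),
      (forall v i j, v \in face i -> v \in face j -> connect (link_rel v) i j) &
      (forall i j, connect face_adj i j)].

Definition euler_char : int :=
  (#|V|%:Z - #|map_edges|%:Z + #|Fc|%:Z)%R.

Definition vertex_of_type (v : V) (t : seq nat) : Prop :=
  exists s : seq Fc,
    [/\ uniq s,
        forall i, (i \in s) = (v \in face i),
        cycle (link_rel v) s &
        exists k, map (fun i => size (face i)) s = rot k t \/
                  map (fun i => size (face i)) s = rot k (rev t)].

Definition semi_equivelar_of_type (t : seq nat) : Prop :=
  forall v : V, vertex_of_type v t.

End Maps.

Definition excluded_types : seq (seq nat) :=
  [:: [:: 3; 3; 3; 3; 8]; [:: 3; 3; 4; 3; 6]; [:: 3; 6; 4; 6];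
      [:: 4; 4; 4; 6]; [:: 4; 8; 12]].

(* Main.v *)
Require Import Defs.
From HB Require Import structures.
From mathcomp Require Import all_boot all_order all_algebra.
From mathcomp Require Import all_fingroup path zify.
Set Implicit Arguments. Unset Strict Implicit. Unset Printing Implicit Defensive.

(* Counting incidences and applying Euler's formula gives 24, 12, 12, 12 and 24
   vertices, hence all numbers of faces by size.  Two distinct faces share at
   most two vertices, and at most one if they are never adjacent around a vertex.
   For (4,8,12), (3,6,4,6) and (3^2,4,3,6) there are then too few faces of one
   size to meet every vertex of a 12-gon, hexagon or square; for (4^3,6), all
   nine squares would have to use distinct edges of one hexagon.

   For (3^4,8) the three octagons partition the vertices.  If v has neighbours
   p, x, y, z, q in cyclic order, with p and q on the octagon of v, then exactly
   one of the edges xy, yz lies on an octagon; orient the star so that it is yz.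
   Then x (as a function of v) satisfies x^3 = 1, p rotates every octagon, and
   t = y o p is a fixed-point-free involution with p = x o t.  But x is even, t is
   a product of 12 transpositions, and p is a product of three 8-cycles, so odd. *)

(** * Permutation parity on the stars of type (3^4,8) *)

(** Used to count cycles, since [odd_perm] is computed from the number of [porbits]. *)
Lemma card_uniform_porbits (T : finType) (s : {perm T}) k :
  (forall x, #|porbit s x| = k) -> #|T| = #|porbits s| * k.
Proof.
move=> sk; rewrite -cardsT; apply: card_uniform_partition.
  by move=> _ /imsetP[x _ ->].
have -> : porbits s = orbit 'P <[s]> @: setT.
  by apply/setP=> A; apply/imsetP/imsetP=> -[x _ ->]; exists x;
    rewrite ?porbit.unlock ?inE.
by apply: orbit_partition; apply/actsP => a _ x; rewrite !inE.
Qed.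

Section SnubParity.
Variables (V C : finType) (c : V -> C) (T : V -> V -> V -> bool) (n : V -> V).

(* T v a b says that v, a, b span a triangle, c v is the octagon through v, and
   n v is the next vertex on it. *)
Definition snub_star (v p x y z q : V) : Prop :=
  [/\ uniq [:: v; p; x; y; z; q],
      [/\ c p = c v, c q = c v, c x <> c v, c y <> c v & c z <> c v],
      n v = p \/ n v = q &
      forall a b, T v a b = ((a, b) \in [:: (p, x); (x, y); (y, z); (z, q);
                                            (x, p); (y, x); (z, y); (q, z)])].

Hypothesis stars : forall v, exists p x y z q, snub_star v p x y z q.
Hypothesis T_swap : forall a b d, T a b d = T a d b.
Hypothesis T_rot : forall a b d, T a b d = T b d a.
Hypothesis nn_neq : forall v, n (n v) <> v.

Lemma snub_star_sym v p x y z q :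
  snub_star v p x y z q -> snub_star v q z y x p.
Proof.
case=> us [cp cq cx cy cz] nv Tv; split=> //; last first.
- move=> a b; rewrite Tv !inE.
  by apply/idP/idP; do ?[case/orP]; move=> ->; rewrite ?orbT.
- by case: nv; [right|left].
move: us; rewrite !(cons_uniq v).
have <- : rev [:: p; x; y; z; q] = [:: q; z; y; x; p] by [].
by rewrite mem_rev rev_uniq.
Qed.

Lemma snub_star_nbr v p x y z q a b : snub_star v p x y z q ->
  T v a b -> c a = c v -> (a = p /\ b = x) \/ (a = q /\ b = z).
Proof.
case=> us [cp cq cx cy cz] _ Tv; rewrite {}Tv !inE !xpair_eqE => {us} H ca.
by do !case/orP: H => H; case/andP: H => /eqP ha /eqP hb; subst; auto.
Qed.

Lemma snub_star_mono v p x y z q a b : snub_star v p x y z q ->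
  T v a b -> c a = c b ->
  [\/ a = x /\ b = y, a = y /\ b = x, a = y /\ b = z | a = z /\ b = y].
Proof.
case=> us [cp cq cx cy cz] _ Tv; rewrite {}Tv !inE !xpair_eqE => {us} H ca.
do !case/orP: H => H; case/andP: H => /eqP ha /eqP hb; subst;
  first [by constructor 1 | by constructor 2
        | by constructor 3 | by constructor 4 | congruence].
Qed.

(** The triangles [vpx] and [vzq] repeat the octagon of [v], and [vyz] repeats that of [y]. The
    remaining triangles, which meet three octagons, become the orbits of [x] in [snub_parity]. *)
Lemma snub_star_rainbow v p x y z q a b : snub_star v p x y z q ->
  T v a b -> c a <> c v -> c b <> c v -> c y = c z -> c a <> c b ->
  (a = x /\ b = y) \/ (a = y /\ b = x).
Proof.
case=> us [cp cq cx cy cz] _ Tv; rewrite {}Tv !inE !xpair_eqE => {us} H ca cb cyz cab.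
do !case/orP: H => H; case/andP: H => /eqP ha /eqP hb; subst; auto; congruence.
Qed.

Lemma snub_star_T v p x y z q : snub_star v p x y z q ->
  [/\ T v p x, T v x y, T v y z & T v z q].
Proof. by case=> us _ nv Tv; rewrite !Tv !inE !eqxx !orbT. Qed.

Lemma snub_star_uniq v p x y z q : snub_star v p x y z q ->
  [/\ v <> p, v <> x, v <> y & v <> z] /\ [/\ x <> y, x <> z, y <> z & p <> q].
Proof.
case=> us _ _ _.
by split; split=> e; move: us; rewrite e /= !inE eqxx ?orbT ?andbF.
Qed.

(** Otherwise [x] and [z] are the two octagon neighbours of [y]. As [v] spans a triangle with [y]
    and each of them, it is both the first and the last of the three off-octagon neighbours of
    [y]. *)
Lemma snub_star_not_both v p x y z q : snub_star v p x y z q ->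
  c x = c y -> c z = c y -> False.
Proof.
move=> sv cxy czy; have [Tvpx Tvxy Tvyz _] := snub_star_T sv.
have [_ [xy xz _ _]] := snub_star_uniq sv.
have [p' [x' [y' [z' [q' sy]]]]] := stars y.
have [_ [_ xz' _ _]] := snub_star_uniq sy.
have Tx : T y x v by rewrite T_swap -2!T_rot.
have Tz : T y z v by rewrite -T_rot.
have := snub_star_nbr sy Tx cxy; have := snub_star_nbr sy Tz czy.
by case=> -[? ?]; case=> -[? ?]; subst.
Qed.

Lemma snub_star_apex v : exists2 w, T v (n v) w & c w <> c v.
Proof.
have [p [x [y [z [q sv]]]]] := stars v.
have [Tp _ _ Tq] := snub_star_T sv.
case: (sv) => _ [_ _ cx _ cz] [] -> _; first by exists x.
by exists z => //; rewrite T_swap.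
Qed.

Lemma color_next v : c (n v) = c v.
Proof.
by have [p [x [y [z [q [_ [cp cq _ _ _] [-> | ->] _]]]]]] := stars v.
Qed.

(* The map sending v to the apex of the triangle on the octagon edge {v, n v} is
   injective, hence onto, so every v is the apex of such a triangle. *)
Lemma snub_star_oriented v : exists p x y z q,
  [/\ snub_star v p x y z q, c y = c z & c x <> c y].
Proof.
have [a Ta ca] : exists2 a : V -> V, forall v, T v (n v) (a v) &
    forall v, c (a v) <> c v.
  by apply: (@fin_all_exists2 _ _ (fun v w => T v (n v) w)
    (fun v w => c w <> c v)) => u; apply: snub_star_apex.
have a_inj : injective a.
  (* Only one edge opposite a vertex lies on an octagon, so equal apexes force
     [{v1, n v1} = {v2, n v2}]; the crossed case gives [n (n v1) = v1]. *)
  move=> v1 v2 a12; have [p [x [y [z [q sw]]]]] := stars (a v1).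
  have T1 : T (a v1) v1 (n v1) by rewrite T_rot.
  have T2 : T (a v1) v2 (n v2) by rewrite a12 T_rot.
  have nb := snub_star_not_both sw.
  have nn1 := @nn_neq v1; have nn2 := @nn_neq v2.
  have cn1 := color_next v1; have cn2 := color_next v2.
  have := snub_star_mono sw T2 (esym cn2).
  have := snub_star_mono sw T1 (esym cn1).
  by do 2!case=> -[? ?]; subst=> //; try congruence; case: nb; congruence.
have [w vw] : exists w, v = a w.
  by have [b ab ba] := injF_bij a_inj; exists (b v).
have Tw : T v w (n w) by rewrite vw T_rot.
have [p [x [y [z [q sv]]]]] := stars v.
have nb := snub_star_not_both sv.
have cn := color_next w.
case: (eqVneq (c y) (c z)) => [cyz|/eqP cyz].
  by exists p, x, y, z, q; split=> // cxy; apply: nb.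
have cxy : c x = c y.
  by case: (snub_star_mono sv Tw (esym cn)) => -[? ?]; subst; congruence.
(* Here [xy] is the octagon edge, so the star is read in the opposite direction. *)
by exists q, z, y, x, p; split; [exact: snub_star_sym | | congruence].
Qed.

Hypothesis color_card : forall v, #|[set w | c w == c v]| = 8.
Hypothesis color_orbit : forall v w, c w = c v -> fconnect n v w.

Lemma snub_parity : #|V| <> 24.
Proof.
(* Finite choice turns the oriented stars into functions [p], [x], [y], [z], [q], one coordinate at
   a time. *)
have [p Hp] : exists p : V -> V, forall v, exists x y z q,
    [/\ snub_star v (p v) x y z q, c y = c z & c x <> c y].
  by apply: (@fin_all_exists _ _ (fun v p => exists x y z q,
    [/\ snub_star v p x y z q, c y = c z & c x <> c y])) => v;
    apply: snub_star_oriented.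
have [x {}Hp] : exists x : V -> V, forall v, exists y z q,
    [/\ snub_star v (p v) (x v) y z q, c y = c z & c (x v) <> c y].
  exact: (@fin_all_exists _ _ (fun v x => exists y z q,
    [/\ snub_star v (p v) x y z q, c y = c z & c x <> c y])).
have [y {}Hp] : exists y : V -> V, forall v, exists z q,
    [/\ snub_star v (p v) (x v) (y v) z q, c (y v) = c z & c (x v) <> c (y v)].
  exact: (@fin_all_exists _ _ (fun v y => exists z q,
    [/\ snub_star v (p v) (x v) y z q, c y = c z & c (x v) <> c y])).
have [z {}Hp] : exists z : V -> V, forall v, exists q,
    [/\ snub_star v (p v) (x v) (y v) (z v) q, c (y v) = c (z v)
      & c (x v) <> c (y v)].
  exact: (@fin_all_exists _ _ (fun v z => exists q,
    [/\ snub_star v (p v) (x v) (y v) z q, c (y v) = c z & c (x v) <> c (y v)])).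
have [q {}Hp] : exists q : V -> V, forall v,
    [/\ snub_star v (p v) (x v) (y v) (z v) (q v), c (y v) = c (z v)
      & c (x v) <> c (y v)].
  exact: (@fin_all_exists _ _ (fun v q =>
    [/\ snub_star v (p v) (x v) (y v) (z v) q, c (y v) = c (z v)
      & c (x v) <> c (y v)])).
have sv v : snub_star v (p v) (x v) (y v) (z v) (q v) by case: (Hp v).
have cyz v : c (y v) = c (z v) by case: (Hp v).
have cxy v : c (x v) <> c (y v) by case: (Hp v).
have cv v : [/\ c (p v) = c v, c (q v) = c v, c (x v) <> c v, c (y v) <> c v
    & c (z v) <> c v] by case: (sv v).
(* The triangle [v], [x v], [y v] meets three octagons, so in the star of [x v] the vertices [v] and
   [y v] fill positions [x] and [y]. The octagon edge from [v] to [p v] is opposite [x v], hence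
   fills positions [y] and [z]; this forces [v] into position [y]. *)
have at_x v : [/\ y (x v) = v, z (x v) = p v & x (x v) = y v].
  have [T1 T2 _ _] := snub_star_T (sv v).
  have [U1 [U2 _ _ _]] := snub_star_uniq (sv v).
  have [cp cq cx cy cz] := cv v.
  have [_ [xy xz _ _]] := snub_star_uniq (sv (x v)).
  have Txp : T (x v) v (p v) by rewrite T_rot.
  have Txy : T (x v) v (y v) by rewrite T_swap -T_rot.
  have cxyv := cxy v.
  have cxyx := cxy (x v).
  case: (snub_star_rainbow (sv (x v)) Txy _ _ (cyz _) _); try congruence.
    by case=> a b; case: (snub_star_mono (sv (x v)) Txp (esym cp)) => -[? ?];
      congruence.
  case=> a b; case: (snub_star_mono (sv (x v)) Txp (esym cp)) => -[? ?];
    by split; congruence.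
have xx v : x (x v) = y v by case: (at_x v).
have xxx v : x (x (x v)) = v by rewrite xx; case: (at_x v).
have x_inj : injective x by move=> u v e; rewrite -(xxx u) e xxx.
(* In the star of [p v], the octagon neighbour [v] is [p (p v)] or [q (p v)]. The first would give
   [x v = x (p v)], against injectivity of [x]. *)
have at_p v : q (p v) = v /\ z (p v) = x v.
  have [T1 T2 _ _] := snub_star_T (sv v).
  have [cp _ _ _ _] := cv v.
  have Tp : T (p v) v (x v) by rewrite T_swap -T_rot.
  have [[vp _ _ _] _] := snub_star_uniq (sv v).
  case: (snub_star_nbr (sv (p v)) Tp (esym cp)) => -[a b]; last by split.
  by case: vp; apply: x_inj.
have pq : cancel p q by move=> v; case: (at_p v).
have p_inj := can_inj pq.
pose t v := y (p v).
have tt v : t (t v) = v.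
  (* By [at_x] and [x^3 = 1], [p (t v) = z (p v) = x v], and [y (x v) = v]. *)
  rewrite /t; have [_ zx] := at_p v.
  have -> : p (y (p v)) = x v.
    by rewrite -zx -(xxx (p v)) -xx; case: (at_x (x (x (p v)))) => _ -> _; rewrite xxx xx.
  by case: (at_x v).
have t_neq v : t v != v.
  apply/eqP => e; have [cp _ _ _ _] := cv v; have [_ _ _ cy _] := cv (p v).
  by apply: cy; rewrite -/(t v) e cp.
have t_inj := can_inj tt.
pose P := perm p_inj; pose X := perm x_inj; pose S := perm t_inj.
(* Permutation products apply the left factor first: [x (t v) = x (x (x (p v))) = p v]. *)
have PE : P = (S * X)%g.
  by apply/permP => v; rewrite permM !permE /t -xx xxx.
have X3 : (X * X * X)%g = 1%g by apply/permP=> v; rewrite !permM !permE xxx.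
have X_even : odd_perm X = false.
  by move: (congr1 (@odd_perm V) X3); rewrite !odd_permM odd_perm1; case: odd_perm.
move=> V24.
have S_even : odd_perm S = false.
  (* Parity is that of 24 plus the number of cycles: 12 for [S] here, 3 for [P] below. *)
  rewrite /odd_perm V24.
  have c2 v : #|porbit S v| = 2.
    have -> : porbit S v = [set v; t v].
      have SSE : (S * S)%g = 1%g by apply/permP=> w; rewrite !permM !permE tt.
      apply/setP=> w; rewrite !inE; apply/porbitP/orP => [[k ->]|].
        elim: k => [|k]; first by left; rewrite expg0 perm1.
        by rewrite expgSr permM permE; case=> /eqP ->; [right|left; rewrite tt].
      by case=> /eqP ->; [exists 0; rewrite expg0 perm1|exists 1; rewrite expg1 permE].
    by rewrite cards2 eq_sym t_neq.
  have := card_uniform_porbits c2.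
  by rewrite V24 => /(congr1 (fun k => k %/ 2)); rewrite mulnK // => <-.
have P_odd : odd_perm P = true.
  have c8 v : #|porbit P v| = 8.
    (* [n u] is [p u] or its preimage [q u], so orbits of [P] are closed under [n] even if [p] and
       [n] turn in opposite directions. *)
    have nP u : n u \in porbit P u.
      have [_ _ [->|->] _] := sv u.
        by have := mem_porbit P 1 u; rewrite expg1 permE.
      rewrite porbit_sym; have := mem_porbit P 1 (q u).
      by rewrite expg1 permE (canF_sym pq).
    rewrite -(color_card v); apply: eq_card => w.
    rewrite inE; apply/idP/eqP => [/porbitP[k ->]|].
      elim: k => [|k IH]; first by rewrite expg0 perm1.
      by rewrite expgSr permM permE; case: (cv ((P ^+ k)%g v)) => -> _ _ _ _.
    move=> /color_orbit/iter_findex <-; elim: (findex _ _ _) => [|k IH] /=.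
      exact: porbit_id.
    by move: IH; rewrite -eq_porbit_mem => /eqP <-.
  have := card_uniform_porbits c8.
  rewrite /odd_perm V24 => /(congr1 (fun k => k %/ 8)).
  by rewrite mulnK // => <-.
by move: P_odd; rewrite PE odd_permM X_even S_even.
Qed.

End SnubParity.

(** * Vertices and edges of a single polygon *)

Section Cycles.
Variable V : finType.
Implicit Types (f : seq V) (v w : V) (e : {set V}).

Lemma next_neq f v : uniq f -> 1 < size f -> v \in f -> next f v != v.
Proof.
move=> uf sf /rot_to[i f' ef]; rewrite -(next_rot i uf) ef.
move: uf sf; rewrite -(rot_uniq i) -(size_rot i f) ef.
by case: f' {ef} => //= w f'; rewrite inE negb_or eqxx eq_sym => /andP[/andP[]].
Qed.

Lemma next_next_neq f v : uniq f -> 2 < size f -> v \in f ->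
  next f (next f v) != v.
Proof.
move=> uf sf /rot_to[i f' ef]; rewrite -!(next_rot i uf) ef.
move: uf sf; rewrite -(rot_uniq i) -(size_rot i f) ef.
case: f' {ef} => [|w [|u f']] //=.
rewrite !inE !negb_or eqxx => /andP[/and3P[vw vu _] _] _.
by rewrite [w == v]eq_sym (negbTE vw) eqxx eq_sym.
Qed.

Lemma next_prev_neq f v : uniq f -> 2 < size f -> v \in f -> next f v != prev f v.
Proof.
move=> uf sf vf; have := @next_next_neq f (prev f v) uf sf.
by rewrite mem_prev next_prev // => /(_ vf).
Qed.

Lemma face_edge_next f v : v \in f -> [set v; next f v] \in face_edges f.
Proof. by move=> vf; apply/imsetP; exists v. Qed.

Lemma face_edge_at f e v : uniq f -> e \in face_edges f -> v \in e ->
  v \in f /\ (e = [set v; next f v] \/ e = [set v; prev f v]).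
Proof.
move=> uf /imsetP[x xf ->]; rewrite !inE => /orP[] /eqP ->; first by auto.
by rewrite mem_next prev_next // setUC; auto.
Qed.

Lemma card_face_edges f : uniq f -> 2 < size f -> #|face_edges f| = size f.
Proof.
move=> uf sf; rewrite -(card_uniqP uf); apply: card_in_imset => x y xf yf exy.
(* If distinct [x] and [y] start the same edge, each is the successor of the other, which is
   impossible in a cycle longer than 2. *)
have: x \in [set y; next f y] by rewrite -exy set21.
rewrite !inE => /orP[/eqP //|/eqP xny].
have: y \in [set x; next f x] by rewrite exy set21.
rewrite !inE => /orP[/eqP //|/eqP ynx].
by have := next_next_neq uf sf xf; rewrite -ynx -xny eqxx.
Qed.

Lemma face_edge_card f e : uniq f -> 2 < size f -> e \in face_edges f -> #|e| = 2.
Proof.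
move=> uf sf /imsetP[x xf ->]; rewrite cards2 eq_sym next_neq //; exact: ltnW.
Qed.

(** The only edges at [v] go to its successor and its predecessor. *)
Lemma face_edges_at f v e1 e2 e3 : uniq f ->
  e1 \in face_edges f -> e2 \in face_edges f -> e3 \in face_edges f ->
  v \in e1 -> v \in e2 -> v \in e3 -> e1 != e2 -> e3 = e1 \/ e3 = e2.
Proof.
move=> uf f1 f2 f3 v1 v2 v3.
have [_] := face_edge_at uf f1 v1; have [_] := face_edge_at uf f2 v2.
have [_] := face_edge_at uf f3 v3.
by move=> [->|->] [->|->] [->|->]; rewrite ?eqxx; auto.
Qed.

End Cycles.

(** * Local structure of a polyhedral map *)

Section Surface.
Variables (V Fc : finType) (face : Fc -> seq V).
Hypothesis surfP : polyhedral_surface_map face.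

Notation E i := (face_edges (face i)).

Lemma face_uniq i : uniq (face i).
Proof. by case: surfP => /(_ i)/andP[]. Qed.

Lemma face_size i : 2 < size (face i).
Proof. by case: surfP => /(_ i)/andP[]. Qed.

Hint Resolve face_uniq face_size : core.

Definition common i j := [set x in face i] :&: [set x in face j].

Lemma common_card i j : i != j -> #|common i j| <= 2.
Proof.
move=> ij; have [_ [_ /(_ i j ij) /= + _ _ _]] := surfP.
rewrite -/(common i j) => /orP[/leq_trans -> // |/andP[/face_edge_card -> //]].
Qed.

Lemma common_edge i j : i != j -> 1 < #|common i j| ->
  common i j \in E i :&: E j.
Proof.
move=> ij; have [_ [_ /(_ i j ij) /= + _ _ _]] := surfP.
by rewrite -/(common i j) inE ltnNge => /orP[->|].
Qed.

Lemma mem_face_edge i e v : e \in E i -> v \in e -> v \in face i.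
Proof. by move=> ei ve; case: (face_edge_at (face_uniq i) ei ve). Qed.

Lemma common_pair i j x y : i != j -> x != y -> x \in common i j ->
  y \in common i j -> common i j = [set x; y].
Proof.
move=> ij xy xc yc; apply/esym/eqP; rewrite eqEcard cards2 xy common_card // andbT.
by apply/subsetP=> u; rewrite !inE => /orP[] /eqP ->; move: xc yc; rewrite !inE.
Qed.

(** Two shared vertices exhaust the intersection of the faces, which must then be a common edge. *)
Lemma pair_edge i j x y : i != j -> x != y -> x \in face i -> x \in face j ->
  y \in face i -> y \in face j -> [set x; y] \in E i :&: E j.
Proof.
move=> ij xy xi xj yi yj.
have xc : x \in common i j by rewrite !inE xi.
have yc : y \in common i j by rewrite !inE yi.
have cE := common_pair ij xy xc yc.
by rewrite -cE common_edge // cE cards2 xy.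
Qed.

Lemma edge_two_faces e i j k : e \in E i -> e \in E j -> e \in E k ->
  i != j -> k = i \/ k = j.
Proof.
move=> ei ej ek ij; have [_ [_ _ /(_ e) He _ _]] := surfP.
have {}He : #|[set i | e \in E i]| = 2 by apply: He; apply/bigcupP; exists i.
have: k \in [set i | e \in E i] by rewrite inE.
have -> : [set i | e \in E i] = [set i; j].
  apply/esym/eqP; rewrite eqEcard He cards2 ij andbT.
  by apply/subsetP=> u; rewrite !inE => /orP[] /eqP ->.
by rewrite !inE => /orP[] /eqP; auto.
Qed.

Lemma link_relP v i j : reflect
  (i != j /\ exists2 e, e \in E i :&: E j & v \in e) (link_rel face v i j).
Proof.
apply: (iffP and4P) => [[_ _ ij /existsP[e /andP[]]]|[ij [e ee ve]]].
  by split=> //; exists e.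
have:= ee; rewrite inE => /andP[ei ej]; split=> //.
- exact: mem_face_edge ei ve.
- exact: mem_face_edge ej ve.
by apply/existsP; exists e; rewrite ee.
Qed.

Lemma link_rel_sym v : symmetric (link_rel face v).
Proof.
move=> i j; apply/link_relP/link_relP => -[ij [e ee ve]];
  by split; [rewrite eq_sym | exists e; rewrite // setIC].
Qed.

Lemma link_rel_meet v i j w : i != j -> v != w -> v \in face i -> v \in face j ->
  w \in face i -> w \in face j -> link_rel face v i j.
Proof.
move=> ij vw vi vj wi wj; apply/link_relP; split=> //.
by exists [set v; w]; [apply: pair_edge | rewrite set21].
Qed.

(** Face [i] shares an edge at [v] with each of its two neighbours in [s]. These edges differ, since
    an edge lies in only two faces, and [i] has no third edge at [v]. *)
Lemma link_cycle_nbr v (s : seq Fc) i j : uniq s -> 2 < size s ->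
  cycle (link_rel face v) s -> i \in s -> link_rel face v i j ->
  j = next s i \/ j = prev s i.
Proof.
move=> us ss cs is_ /link_relP[ij [e]]; rewrite inE => /andP[ei ej] ve.
have /link_relP[in_ [e1]] := next_cycle cs is_.
rewrite inE => /andP[e1i e1n] ve1.
have /link_relP[ip_ [e2]] := prev_cycle cs is_.
rewrite inE => /andP[e2p e2i] ve2.
have np := next_prev_neq us ss is_.
have e12 : e1 != e2.
  apply/eqP => e12; rewrite -e12 in e2p.
  by case: (edge_two_faces e1i e1n e2p in_) => e'; move: ip_ np; rewrite e' eqxx.
case: (face_edges_at (face_uniq i) e1i e2i ei ve1 ve2 ve e12) => ee; subst e.
  by left; case: (edge_two_faces e1i e1n ej in_) => // ji; rewrite ji eqxx in ij.
right; case: (edge_two_faces e2i e2p ej _) => //; first by rewrite eq_sym.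
by move=> ji; rewrite ji eqxx in ij.
Qed.

(** Rotating or reversing the list of faces absorbs the freedom in [vertex_of_type]; reversal keeps
    a cycle because [link_rel] is symmetric. *)
Lemma vertex_typeP v t : vertex_of_type face v t -> exists s : seq Fc,
  [/\ uniq s, forall i, (i \in s) = (v \in face i), cycle (link_rel face v) s &
      map (fun i => size (face i)) s = t].
Proof.
case=> s [us ms cs [k [] st]].
  exists (rotr k s); rewrite rotr_uniq rotr_cycle map_rotr st rotK.
  by split=> // i; rewrite mem_rotr.
exists (rev (rotr k s)); rewrite rev_uniq rotr_uniq rev_cycle map_rev map_rotr.
rewrite st rotK revK; split=> // [i|]; first by rewrite mem_rev mem_rotr.
by rewrite (eq_cycle (fun a b => link_rel_sym v b a)) rotr_cycle.
Qed.

Definition faces_of_size k := [set i | size (face i) == k].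

(** * Incidence counts for a semi-equivelar map *)

Section Count.
Variable t : seq nat.
Hypothesis tP : semi_equivelar_of_type face t.

Lemma card_faces_at v k :
  #|[set i in faces_of_size k | v \in face i]| = count_mem k t.
Proof.
have [s [us ms _ <-]] := vertex_typeP (tP v).
rewrite count_map -size_filter -(card_uniqP (filter_uniq _ us)).
by apply: eq_card => i; rewrite !inE mem_filter ms.
Qed.

Lemma sum_face_size (P : pred Fc) : \sum_(i | P i) size (face i) =
  \sum_(v : V) #|[set i | P i & v \in face i]|.
Proof.
under eq_bigr => i _ do rewrite -(card_uniqP (face_uniq i)) -sum1_card.
rewrite (exchange_big_dep xpredT) //=; apply: eq_bigr => v _.
by rewrite sum1dep_card; apply: eq_card => i; rewrite !inE.
Qed.

Lemma card_faces_of_size k : #|faces_of_size k| * k = #|V| * count_mem k t.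
Proof.
rewrite -sum_nat_const.
rewrite (eq_bigr (fun i => size (face i))) => [|i]; last by rewrite inE => /eqP.
rewrite sum_face_size -sum_nat_const.
by apply: eq_bigr => v _; rewrite -(card_faces_at v).
Qed.

(** A face has as many edges as vertices, so face-edge incidences (two per edge) equal face-vertex
    incidences ([size t] per vertex). *)
Lemma card_map_edges : #|map_edges face| * 2 = #|V| * size t.
Proof.
have -> : #|V| * size t = \sum_i size (face i).
  rewrite sum_face_size -sum_nat_const; apply: eq_bigr => v _.
  have [s [us ms _ <-]] := vertex_typeP (tP v).
  by rewrite size_map -(card_uniqP us); apply: eq_card => i; rewrite !inE ms ?andTb.
under eq_bigr => i _ do rewrite -(card_face_edges (face_uniq i) (face_size i)) -sum1_card.
rewrite (exchange_big_dep (mem (map_edges face))) /=; last first.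
  by move=> i e _ ei; apply/bigcupP; exists i.
rewrite -sum_nat_const; apply: eq_bigr => e em.
have [_ [_ _ /(_ e em) <- _ _]] := surfP.
by rewrite sum1dep_card.
Qed.

Lemma face_size_type i : size (face i) \in t.
Proof.
have: 0 < size (face i) by apply: leq_trans (face_size i).
case ef: (face i) => [|v f] // _; rewrite -ef.
have [s [_ ms _ <-]] := vertex_typeP (tP v).
by apply/mapP; exists i; rewrite // ms ef mem_head.
Qed.

Lemma card_faces : #|Fc| = \sum_(k <- undup t) #|faces_of_size k|.
Proof.
rewrite -sum1_card.
rewrite (eq_bigr (fun i => \sum_(k <- undup t) (size (face i) == k))); last first.
  move=> i _; rewrite -big_mkcond /= sum1_count.
  by rewrite (eq_count (fun k => eq_sym _ _)) count_uniq_mem ?undup_uniq //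
    mem_undup face_size_type.
rewrite exchange_big; apply: eq_bigr => k _ /=.
by rewrite -big_mkcond sum1dep_card; apply: eq_card => i; rewrite !inE.
Qed.

End Count.

(** * Overlaps, adjacency and triangles *)

(** Union bound over the overlaps of [face i] with the faces in [P]. It will contradict the face
    counts when [P] is too small. *)
Lemma cover_bound i (P : {set Fc}) m :
  (forall v, v \in face i -> exists2 j, j \in P & v \in face j) ->
  (forall j, j \in P -> #|common i j| <= m) -> size (face i) <= #|P| * m.
Proof.
move=> cov le_m; rewrite -(card_uniqP (face_uniq i)) -sum_nat_const.
apply: (@leq_trans (\sum_(j in P) #|common i j|)); last exact: leq_sum.
apply: (@leq_trans #|\bigcup_(j in P) common i j|).
  apply/subset_leq_card/subsetP=> v vi; have [j jP vj] := cov v vi.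
  by apply/bigcupP; exists j; rewrite // !inE vi.
apply: (big_ind2 (fun (A : {set V}) k => #|A| <= k)) => //; first by rewrite cards0.
move=> A a B b Aa Bb; apply: leq_trans (leq_card_setU A B) _; exact: leq_add.
Qed.

Lemma common_nonadjacent i j : i != j ->
  (forall v, ~~ link_rel face v i j) -> #|common i j| <= 1.
Proof.
move=> ij nl; rewrite leqNgt; apply/negP => /card_gt1P[x [y [+ + xy]]].
rewrite !inE => /andP[xi xj] /andP[yi yj].
by case/negP: (nl x); apply: (link_rel_meet ij xy).
Qed.

(** Faces adjacent around [v] are consecutive in its cycle. Taking for [r] the exclusion of one pair
    of sizes shows that faces of these sizes are never adjacent. *)
Lemma link_rel_size (t : seq nat) (r : rel nat) v i j :
  semi_equivelar_of_type face t -> symmetric r -> 2 < size t -> cycle r t ->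
  link_rel face v i j -> r (size (face i)) (size (face j)).
Proof.
move=> tP rs t2 ct lij; have [s [us ms cs st]] := vertex_typeP (tP v).
have is_ : i \in s by rewrite ms; case/and4P: lij.
have s2 : 2 < size s by rewrite -(size_map (fun i => size (face i))) st.
rewrite -st cycle_map in ct.
case: (link_cycle_nbr us s2 cs is_ lij) => ->; first exact: (next_cycle ct).
by rewrite rs; apply: (prev_cycle ct).
Qed.

Lemma face_of_size_at t v k : semi_equivelar_of_type face t -> k \in t ->
  exists2 i, i \in faces_of_size k & v \in face i.
Proof.
move=> tP; rewrite -has_pred1 has_count -(card_faces_at tP v k).
by case/card_gt0P => i; rewrite !inE => /andP[ik vi]; exists i; rewrite // inE.
Qed.

Lemma face_of_size_unique t v k i j : semi_equivelar_of_type face t ->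
  count_mem k t = 1 -> size (face i) = k -> size (face j) = k ->
  v \in face i -> v \in face j -> i = j.
Proof.
move=> tP; rewrite -(card_faces_at tP v k) => /eqP/cards1P[a ea] si sj vi vj.
have: i \in [set a] by rewrite -ea !inE si eqxx vi.
have: j \in [set a] by rewrite -ea !inE sj eqxx vj.
by rewrite !inE => /eqP -> /eqP ->.
Qed.

Lemma triangle_face i v a b w : size (face i) = 3 -> uniq [:: v; a; b] ->
  v \in face i -> a \in face i -> b \in face i ->
  (w \in face i) = (w \in [:: v; a; b]).
Proof.
move=> si u vi ai bi; have sub : {subset [:: v; a; b] <= face i}.
  by move=> u'; rewrite !inE => /or3P[] /eqP ->.
by have [_ ->] := uniq_min_size u sub (eq_leq si).
Qed.

(** The edge [[set v; w]] would lie in three faces. *)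
Lemma three_faces i j k v w : i != j -> i != k -> j != k -> v != w ->
  v \in face i -> v \in face j -> v \in face k ->
  w \in face i -> w \in face j -> w \in face k -> False.
Proof.
move=> ij ik jk vw vi vj vk wi wj wk.
have := pair_edge ij vw vi vj wi wj.
have := pair_edge ik vw vi vk wi wk; rewrite !inE => /andP[e1 e2] /andP[_ e3].
by case: (edge_two_faces e1 e3 e2 ij) => e; [rewrite e eqxx in ik|rewrite e eqxx in jk].
Qed.

Lemma link_rel_nbr v i j : link_rel face v i j ->
  exists w, [/\ v != w, w \in face i & w \in face j].
Proof.
case/link_relP=> ij [e]; rewrite inE => /andP[ei ej] ve.
have := face_edge_card (face_uniq i) (face_size i) ei.
move/eqP/cards2P => [a [b [ab ee]]].
have me w : w \in [set a; b] -> w \in face i /\ w \in face j.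
  by rewrite -ee => we; split; [apply: mem_face_edge ei we|apply: mem_face_edge ej we].
have [[ai aj] [bi bj]] := (me a (set21 a b), me b (set22 a b)).
move: ve; rewrite ee !inE => /orP[] /eqP ->; first by exists b.
by exists a; rewrite eq_sym.
Qed.

(** Instance of the relation [T] of the parity argument. *)
Definition triangle v a b := [exists i, [&& size (face i) == 3, uniq [:: v; a; b],
  v \in face i, a \in face i & b \in face i]].

Lemma triangle_swap v a b : triangle v a b = triangle v b a.
Proof.
have sw x y : triangle v x y -> triangle v y x.
  case/existsP=> i /and5P[si u vi xi yi]; apply/existsP; exists i.
  rewrite si vi xi yi !andbT; move: u.
  by rewrite /= !inE !negb_or !andbT (eq_sym y x) [(v != x) && _]andbC.
by apply/idP/idP; apply: sw.
Qed.

Lemma triangle_rot v a b : triangle v a b = triangle a b v.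
Proof.
have sw x y w : triangle x y w -> triangle y w x.
  case/existsP=> i /and5P[si u xi yi wi]; apply/existsP; exists i.
  by rewrite si xi yi wi -(rot_uniq 2) u.
by apply/idP/idP => [/sw //|/sw/sw].
Qed.

(** Consecutive faces around [v] share an edge at [v]; its other ends are [p], [x], [y], [z], [q]. A
    coincidence among these, or one of [x], [y], [z] on the octagon, would put an edge in three
    faces. *)
Lemma snub_star_of_type v o : semi_equivelar_of_type face [:: 3; 3; 3; 3; 8] ->
  size (face o) = 8 -> v \in face o ->
  exists p x y z q,
    [/\ uniq [:: v; p; x; y; z; q],
        p \in face o /\ q \in face o,
        [/\ x \notin face o, y \notin face o & z \notin face o],
        next (face o) v = p \/ next (face o) v = q &
        forall a b, triangle v a b = ((a, b) \in
          [:: (p, x); (x, y); (y, z); (z, q); (x, p); (y, x); (z, y); (q, z)])].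
Proof.
move=> tP so vo; have [s [us ms]] := vertex_typeP (tP v).
case: s us ms => [|t1 [|t2 [|t3 [|t4 [|o' []]]]]] //= us ms cs [s1 s2 s3 s4 so'].
have vs i : i \in [:: t1; t2; t3; t4; o'] -> v \in face i by rewrite ms.
have oo : o' = o.
  by apply: (face_of_size_unique (v := v) (k := 8) tP) => //; apply: vs; rewrite !inE eqxx !orbT.
subst o'; case/and5P: cs => l12 l23 l34 l4o /andP[lo1 _].
have [p [vp po p1]] := link_rel_nbr lo1.
have [x [vx x1 x2]] := link_rel_nbr l12.
have [y [vy y2 y3]] := link_rel_nbr l23.
have [z [vz z3 z4]] := link_rel_nbr l34.
have [q [vq q4 qo]] := link_rel_nbr l4o.
have v1 : v \in face t1 by apply: vs; rewrite !inE eqxx.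
have v2 : v \in face t2 by apply: vs; rewrite !inE eqxx !orbT.
have v3 : v \in face t3 by apply: vs; rewrite !inE eqxx !orbT.
have v4 : v \in face t4 by apply: vs; rewrite !inE eqxx !orbT.
have [[n12 n13 n14 n1o] [n23 n24 n2o] [n34 n3o] n4o] :
  [/\ [/\ t1 != t2, t1 != t3, t1 != t4 & t1 != o], [/\ t2 != t3, t2 != t4 & t2 != o],
      t3 != t4 /\ t3 != o & t4 != o].
  move: us; rewrite !inE !negb_or andbT.
  by case/and4P=> /and4P[-> -> -> ->] /and3P[-> -> ->] /andP[-> ->] ->.
have px : p != x.
  apply/eqP=> e.
  by case: (three_faces n12 n1o n2o vp v1 v2 vo); rewrite // e.
have py : p != y.
  apply/eqP=> e.
  by case: (three_faces n12 n1o n2o vp v1 v2 vo); rewrite // e.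
have pz : p != z.
  apply/eqP=> e.
  by case: (three_faces n13 n1o n3o vp v1 v3 vo); rewrite // e.
have pq : p != q.
  apply/eqP=> e.
  by case: (three_faces n14 n1o n4o vp v1 v4 vo); rewrite // e.
have xy : x != y.
  apply/eqP=> e.
  by case: (three_faces n12 n13 n23 vx v1 v2 v3); rewrite // e.
have xz : x != z.
  apply/eqP=> e.
  by case: (three_faces n12 n13 n23 vx v1 v2 v3); rewrite // e.
have xq : x != q.
  apply/eqP=> e.
  by case: (three_faces n12 n14 n24 vx v1 v2 v4); rewrite // e.
have yz : y != z.
  apply/eqP=> e.
  by case: (three_faces n23 n24 n34 vy v2 v3 v4); rewrite // e.
have yq : y != q.
  apply/eqP=> e.
  by case: (three_faces n23 n2o n3o vy v2 v3 vo); rewrite // e.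
have zq : z != q.
  apply/eqP=> e.
  by case: (three_faces n34 n3o n4o vz v3 v4 vo); rewrite // e.
have U : uniq [:: v; p; x; y; z; q].
  by rewrite /= !inE !negb_or vp vx vy vz vq px py pz pq xy xz xq yz yq zq.
(* A triangle at [v] has just two other vertices, so it yields one pair up to order. *)
have nbr t m w : size (face t) = 3 -> v \in face t -> uniq [:: v; m; w] ->
    m \in face t -> w \in face t -> forall a b, uniq [:: v; a; b] ->
    a \in face t -> b \in face t -> (a, b) \in [:: (m, w); (w, m)].
  move=> st vt uvm mt wt a b.
  rewrite (triangle_face a st uvm vt mt wt) (triangle_face b st uvm vt mt wt).
  rewrite !inE !xpair_eqE.
  rewrite /= !inE !negb_or andbT => /andP[/andP[va vb] ab].
  rewrite ![_ == v]eq_sym (negbTE va) (negbTE vb) /=.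
  case/orP=> /eqP ea /orP[] /eqP eb; subst; rewrite ?eqxx ?orbT //;
    by rewrite eqxx in ab.
have tri t a b : t \in [:: t1; t2; t3; t4] -> uniq [:: v; a; b] ->
    a \in face t -> b \in face t -> triangle v a b.
  move=> tt u at_ bt; apply/existsP; exists t; rewrite u at_ bt !andbT /=.
  by move: tt; rewrite !inE => /or4P[] /eqP ->; rewrite ?s1 ?s2 ?s3 ?s4 ?v1 ?v2 ?v3 ?v4.
have [u1 u2 u3 u4] : [/\ uniq [:: v; p; x], uniq [:: v; x; y], uniq [:: v; y; z]
    & uniq [:: v; z; q]].
  by rewrite /= !inE !negb_or vp vx vy vz vq px xy yz zq.
exists p, x, y, z, q; split=> //.
- split; apply/negP=> h.
  + exact: three_faces n12 n1o n2o vx v1 v2 vo x1 x2 h.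
  + exact: three_faces n23 n2o n3o vy v2 v3 vo y2 y3 h.
  + exact: three_faces n34 n3o n4o vz v3 v4 vo z3 z4 h.
- rewrite eq_sym in n1o; rewrite eq_sym in n4o.
  have := pair_edge n1o vp vo v1 po p1; rewrite inE => /andP[e1 _].
  have := pair_edge n4o vq vo v4 qo q4; rewrite inE => /andP[e2 _].
  have nv : next (face o) v != v.
    by apply: next_neq => //; apply: ltnW; apply: face_size.
  have e12 : [set v; p] != [set v; q].
    apply/eqP=> e; have := set22 v p; rewrite e !inE (negbTE pq) orbF eq_sym.
    by rewrite (negbTE vp).
  case: (face_edges_at (face_uniq o) e1 e2 (face_edge_next vo) (set21 _ _) (set21 _ _)
    (set21 _ _) e12) => e; have := set22 v (next (face o) v);
    by rewrite e !inE (negbTE nv) => /eqP; auto.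
move=> a b; apply/idP/idP.
  case/existsP=> i /and5P[/eqP si u vi ai bi].
  have: i \in [:: t1; t2; t3; t4; o] by rewrite ms.
  rewrite !inE => /or4P[/eqP e|/eqP e|/eqP e|/orP[/eqP e|/eqP e]]; subst i.
  - have := nbr _ _ _ s1 v1 u1 p1 x1 a b u ai bi.
    by rewrite !inE => /orP[] ->; rewrite ?orbT.
  - have := nbr _ _ _ s2 v2 u2 x2 y2 a b u ai bi.
    by rewrite !inE => /orP[] ->; rewrite ?orbT.
  - have := nbr _ _ _ s3 v3 u3 y3 z3 a b u ai bi.
    by rewrite !inE => /orP[] ->; rewrite ?orbT.
  - have := nbr _ _ _ s4 v4 u4 z4 q4 a b u ai bi.
    by rewrite !inE => /orP[] ->; rewrite ?orbT.
  by rewrite so in si.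
have T1 := tri t1 _ _ _ u1 p1 x1; have T2 := tri t2 _ _ _ u2 x2 y2.
have T3 := tri t3 _ _ _ u3 y3 z3; have T4 := tri t4 _ _ _ u4 z4 q4.
rewrite !inE !eqxx !orbT in T1 T2 T3 T4.
rewrite !inE !xpair_eqE => h; do ?case/orP: h => h;
  case/andP: h => /eqP -> /eqP ->; first [exact: T1|exact: T2|exact: T3|exact: T4
  |rewrite triangle_swap; first [exact: T1|exact: T2|exact: T3|exact: T4]].
Qed.

(** * Excluding each type at Euler characteristic -1 *)

Section EulerMinusOne.
Hypothesis chiN1 : euler_char face = (-1)%R.

Lemma euler_nat : #|V| + #|Fc| + 1 = #|map_edges face|.
Proof. by move: chiN1; rewrite /euler_char; lia. Qed.

Lemma not_type_4_8_12 : ~ semi_equivelar_of_type face [:: 4; 8; 12].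
Proof.
move=> tP; have := euler_nat; have := card_faces tP; have := card_map_edges tP.
have := card_faces_of_size tP 4; have := card_faces_of_size tP 8.
have := card_faces_of_size tP 12.
rewrite /= !big_cons big_nil /= => c12 c8 c4 cE cF eu.
(* The counts force 24 vertices, 6 squares, 3 octagons and 2 dodecagons; the octagons reach at most
   6 vertices of a dodecagon. *)
have : 0 < #|faces_of_size 12| by lia.
case/card_gt0P => i; rewrite inE => /eqP si.
have := @cover_bound i (faces_of_size 8) 2; rewrite si => bd.
suff: 12 <= #|faces_of_size 8| * 2 by lia.
apply: bd => [v vi|j]; first exact: (face_of_size_at v tP).
rewrite inE => /eqP sj; apply: common_card.
by apply/eqP => e; move: sj; rewrite -e si.
Qed.

Lemma not_type_3_6_4_6 : ~ semi_equivelar_of_type face [:: 3; 6; 4; 6].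
Proof.
move=> tP; have := euler_nat; have := card_faces tP; have := card_map_edges tP.
have := card_faces_of_size tP 3; have := card_faces_of_size tP 4.
have := card_faces_of_size tP 6.
rewrite /= !big_cons big_nil /= => c6 c4 c3 cE cF eu.
have : 0 < #|faces_of_size 6| by lia.
case/card_gt0P => i i6; have := i6; rewrite inE => /eqP si.
have := @cover_bound i (faces_of_size 6 :\ i) 1; rewrite si => bd.
(* There are 12 vertices and 4 hexagons, so the other three hexagons meet [i] in at most 3
   vertices. *)
suff: 6 <= #|faces_of_size 6 :\ i| * 1.
  by have := cardsD1 i (faces_of_size 6); rewrite i6 /=; lia.
apply: bd => [v vi|j].
  have := card_faces_at tP v 6; rewrite (cardsD1 i) !inE si eqxx vi /= => -[].
  move/eqP/cards1P=> [j ej]; have: j \in [set j] by rewrite inE.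
  by rewrite -ej !inE => /and3P[ji sj vj]; exists j; rewrite // !inE ji.
rewrite !inE eq_sym => /andP[ij /eqP sj]; apply: common_nonadjacent => // v.
pose r a b := ~~ ((a == 6) && (b == 6)).
have r_sym : symmetric r by move=> a b; rewrite /r andbC.
by apply/negP => /(link_rel_size tP r_sym isT isT); rewrite si sj.
Qed.

Lemma not_type_3_3_4_3_6 : ~ semi_equivelar_of_type face [:: 3; 3; 4; 3; 6].
Proof.
move=> tP; have := euler_nat; have := card_faces tP; have := card_map_edges tP.
have := card_faces_of_size tP 3; have := card_faces_of_size tP 4.
have := card_faces_of_size tP 6.
rewrite /= !big_cons big_nil /= => c6 c4 c3 cE cF eu.
have : 0 < #|faces_of_size 4| by lia.
case/card_gt0P => i; rewrite inE => /eqP si.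
have := @cover_bound i (faces_of_size 6) 1; rewrite si => bd.
(* There are only 2 hexagons, each meeting the square in at most one vertex. *)
suff: 4 <= #|faces_of_size 6| * 1 by lia.
apply: bd => [v vi|j]; first exact: (face_of_size_at v tP).
rewrite inE => /eqP sj; apply: common_nonadjacent => [|v].
  by apply/eqP => e; move: sj; rewrite -e si.
pose r a b := (minn a b, maxn a b) != (4, 6).
have r_sym : symmetric r by move=> a b; rewrite /r minnC maxnC.
by apply/negP => /(link_rel_size tP r_sym isT isT); rewrite si sj.
Qed.

Lemma not_type_4_4_4_6 : ~ semi_equivelar_of_type face [:: 4; 4; 4; 6].
Proof.
move=> tP; have := euler_nat; have := card_faces tP; have := card_map_edges tP.
have := card_faces_of_size tP 4; have := card_faces_of_size tP 6.
rewrite /= !big_cons big_nil /= => c6 c4 cE cF eu.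
have h2 : #|faces_of_size 6| == 2 by lia.
case/cards2P: h2 => a [b [ab hE]].
have sa : size (face a) = 6.
  by have := set21 a b; rewrite -hE inE => /eqP.
have sq i : size (face i) = 4 -> i != a /\ 1 < #|common i a|.
  move=> si; have ia : i != a by apply/eqP => e; move: si; rewrite e sa.
  split=> //; have ib : i != b.
    by apply/eqP => e; have := set22 a b; rewrite -hE inE -e si.
  (* The two hexagons cover all vertices and each takes at most two of the square, so [a] takes at
     least two. *)
  have sub : [set x in face i] \subset common i a :|: common i b.
    apply/subsetP=> v; rewrite !inE => vi; rewrite vi /=.
    have [|h] := @face_of_size_at _ v 6 tP; first by [].
    by rewrite hE !inE => /orP[] /eqP -> ->; rewrite ?orbT.
  suff: 4 <= #|common i a| + 2 by rewrite addn2.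
  rewrite -{1}si -(card_uniqP (face_uniq i)) -[X in X <= _]cardsE.
  apply: leq_trans (subset_leq_card sub) (leq_trans (leq_card_setU _ _) _).
  by rewrite leq_add2l common_card.
(* There are 9 squares, while [a] has 6 edges. Sending a square to its common edge with [a] is
   injective, as an edge lies in only two faces. *)
suff: #|faces_of_size 4| <= #|E a| by rewrite card_face_edges // sa; lia.
have inj : {in faces_of_size 4 &, injective (common a)}.
  move=> i j; rewrite !inE => /eqP/sq[ia ci] /eqP/sq[ja cj] eij.
  have := common_edge ia ci; have := common_edge ja cj.
  rewrite /common ![_ :&: [set x in face a]]setIC -/(common _ _) -eij.
  rewrite !inE => /andP[e1 e2] /andP[e3 _].
  case: (edge_two_faces e3 e2 e1 ia) => // e; by rewrite e eqxx in ja.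
rewrite -(card_in_imset inj); apply/subset_leq_card/subsetP=> e /imsetP[i + ->].
rewrite inE => /eqP/sq[ia ci]; have := common_edge ia ci.
by rewrite /common setIC inE => /andP[].
Qed.

Lemma not_type_3_3_3_3_8 : ~ semi_equivelar_of_type face [:: 3; 3; 3; 3; 8].
Proof.
move=> tP; have := euler_nat; have := card_faces tP; have := card_map_edges tP.
have := card_faces_of_size tP 3; have := card_faces_of_size tP 8.
rewrite /= !big_cons big_nil /= => c8 c3 cE cF eu.
have V24 : #|V| = 24 by move=> /=; lia.
have [c co vc] : exists2 c : V -> Fc, forall v, size (face (c v)) = 8 &
    forall v, v \in face (c v).
  apply: (@fin_all_exists2 _ _ (fun v o => size (face o) = 8)
    (fun v o => v \in face o)) => v.
  have [|o] := @face_of_size_at _ v 8 tP; first by [].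
  by rewrite inE => /eqP so vo; exists o.
(* Octagons partition the vertices: the colour class of [v] is the vertex set of its octagon. *)
have cE' v w : (c w == c v) = (w \in face (c v)).
  apply/eqP/idP => [<-|wv]; first exact: vc.
  exact: (face_of_size_unique (v := w) (k := 8) tP).
apply: (@snub_parity V Fc c triangle (fun v => next (face (c v)) v)) V24.
- move=> v; have [p [x [y [z [q [U [po qo] [xo yo zo] nv tri]]]]]] :=
    snub_star_of_type tP (co v) (vc v).
  exists p, x, y, z, q; split=> //.
  by split; apply/eqP; rewrite ?cE'.
- exact: triangle_swap.
- exact: triangle_rot.
- move=> v; have /eqP -> : c (next (face (c v)) v) == c v by rewrite cE' mem_next.
  by apply/eqP; apply: next_next_neq.
- move=> v; rewrite -(co v) -(card_uniqP (face_uniq (c v))).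
  by apply: eq_card => w; rewrite inE cE'.
move=> v w /eqP; rewrite cE' => wv.
(* The colour is constant along an octagon, so the successor map follows this one cycle and its
   orbit is the whole octagon. *)
have cyc : fcycle (fun u => next (face (c u)) u) (face (c v)).
  apply: cycle_from_next => //= u uv; have /eqP -> : c u == c v by rewrite cE'.
  exact: eqxx.
by rewrite (fconnect_cycle cyc).
Qed.

End EulerMinusOne.
End Surface.

Theorem theorem2 (V Fc : finType) (face : Fc -> seq V) :
  polyhedral_surface_map face ->
  euler_char face = (-1)%R ->
  forall t, t \in excluded_types -> ~ semi_equivelar_of_type face t.
Proof.
move=> surfP chi t; rewrite !inE => /or4P[|||/orP[]] /eqP ->.
- exact: not_type_3_3_3_3_8.
- exact: not_type_3_3_4_3_6.
- exact: not_type_3_6_4_6.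
- exact: not_type_4_4_4_6.
exact: not_type_4_8_12.
Qed.
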